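(* Let $n>0$ and let $K$ be a tileable $n$-dimensional simplicial complex. Then all its skeletons $K^{(i)}$, $i\in\{1,\ldots,n\}$, and all its iterated barycentric subdivisions are tileable. Moreover, any tiling of $K$ induces a tiling on its skeletons and barycentric subdivisions.
   Context: For $m>0$ and $s\in\{0,\ldots,m+1\}$, a tile of type $T_s^m$ is a closed $m$-simplex deprived of $s$ of its (closed) facets; so $T_0^m$ is the closed $m$-simplex and $T_{m+1}^m$ is the open $m$-simplex. A tiling of an $m$-dimensional simplicial complex $X$ is a partition of $|X|$ into disjoint tiles, each of the form $\sigma$ deprived of $s$ of its facets for some $m$-simplex $\sigma$ of $X$ and some $s\in\{0,\ldots,m+1\}$; $X$ is tileable if it has a tiling. $K^{(i)}$ is the $i$-skeleton of $K$ (for $i=n$ it is $K$). ''Induces'' means that the new tiling is compatible with the given one: the tiling of $K^{(i)}$ is such that the intersection of each tile of $K$ with $|K^{(i)}|$ is a disjoint union of $i$-dimensional tiles of the tiling of $K^{(i)}$; the tiling of the barycentric subdivision $\mathrm{Sd}(K)$ is such that each tile of $K$ is a disjoint union of tiles of the tiling of $\mathrm{Sd}(K)$ (and similarly, by iteration, for $\mathrm{Sd}^d(K)$). *)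

(* Defs.v *)
From HB Require Import structures.
From mathcomp Require Import all_boot all_order all_algebra.
From mathcomp Require Import finmap.
From mathcomp Require Import boolp classical_sets reals.

Set Implicit Arguments.
Unset Strict Implicit.
Unset Printing Implicit Defensive.

Import Order.TTheory GRing.Theory Num.Theory.

Local Open Scope classical_set_scope.
Local Open Scope ring_scope.

(* Simplicial complexes are geometric complexes in an arbitrary real vector
   space E, given by the set of the vertex sets of their simplices, so that the
   underlying spaces of a complex, of its skeletons and of its barycentric
   subdivisions are subsets of the same E.  Since E may be infinite
   dimensional, every abstract simplicial complex, finite or not, has such a
   realization. *)

Section Complexes.
Context {R : realType} {E : lmodType R}.
Implicit Types (s f : {fset E}) (c : {fset {fset E}}) (K X : set {fset E}).
Implicit Types (t A : set E) (T : set (set E)).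

Definition affinely_independent s : Prop :=
  forall w : E -> R,
    \sum_(v <- s) w v = 0 -> \sum_(v <- s) w v *: v = 0 ->
    forall v, v \in s -> w v = 0.

(* conv fset0 = set0, because an empty sum of weights is not 1. *)
Definition conv s : set E :=
  [set x | exists w : E -> R,
    [/\ forall v, v \in s -> 0 <= w v,
        \sum_(v <- s) w v = 1
      & x = \sum_(v <- s) w v *: v]].

Definition simplicial_complex K : Prop :=
  [/\ forall s, K s -> s != fset0 /\ affinely_independent s,
      forall s f, K s -> f != fset0 -> (f `<=` s)%fset -> K f
    & forall s s', K s -> K s' -> conv s `&` conv s' = conv (s `&` s')%fset].

Definition has_dimension K (n : nat) : Prop :=
  (forall s, K s -> (#|` s| <= n.+1)%N) /\ (exists2 s, K s & #|` s| = n.+1).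

Definition space K : set E := \bigcup_(s in K) conv s.

Definition skeleton (i : nat) K : set {fset E} :=
  [set s | K s /\ (#|` s| <= i.+1)%N].

Definition barycenter s : E := (#|` s|%:R)^-1 *: \sum_(v <- s) v.

(* The simplices of Sd(K) are spanned by the barycenters of the nonempty finite
   chains, for inclusion, of simplices of K. *)
Definition Sd K : set {fset E} :=
  [set b | exists c,
    [/\ c != fset0,
        forall s, s \in c -> K s,
        forall s s', s \in c -> s' \in c -> (s `<=` s')%fset \/ (s' `<=` s)%fset
      & b = [fset barycenter s | s in c]%fset]].

Definition is_facet s f : Prop := (f `<=` s)%fset /\ #|` s| = (#|` f|).+1.

Definition is_tile X (m k : nat) t : Prop :=
  exists s c,
    [/\ X s /\ #|` s| = m.+1,
        (forall f, f \in c -> is_facet s f) /\ #|` c| = k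
      & t = conv s `\` \bigcup_(f in [set` c]) conv f].

(* A tiling is given by the set of its tiles; the nonemptiness of the blocks
   which is part of [partition] is automatic for tiles of dimension m > 0. *)
Definition is_tiling (m : nat) X T : Prop :=
  [/\ simplicial_complex X,
      has_dimension X m,
      forall t, T t -> exists2 k, (k <= m.+1)%N & is_tile X m k t
    & partition T id (space X)].

Definition tileable (m : nat) X : Prop := exists T, is_tiling m X T.

Definition disjoint_union_of T A : Prop :=
  exists2 U : set (set E), U `<=` T & partition U id A.

Definition induces_on_skeleton T (i : nat) K T' : Prop :=
  is_tiling i (skeleton i K) T' /\
  forall t, T t -> disjoint_union_of T' (t `&` space (skeleton i K)).

Definition induces_on_Sd (n : nat) T (d : nat) K T' : Prop :=
  is_tiling n (iter d Sd K) T' /\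
  forall t, T t -> disjoint_union_of T' t.

End Complexes.

(* Main.v *)
Require Import Defs.
From mathcomp Require Import all_boot all_order all_algebra.
From mathcomp Require Import finmap.
From mathcomp Require Import boolp classical_sets reals.

(** A closed simplex is the disjoint union of the relative interiors of its
nonempty faces.  If [s] is deprived of the facets opposite to the vertices of a
subset [r], what remains is the union of the relative interiors of the faces
[f] with [r <= f <= s] ([cell_facets]).  So a tile is a Boolean interval
[[r, s]], and to tile a complex is to partition the set of its simplices into
intervals whose tops have maximal cardinality.  Since the relative interiors of
the simplices of a complex are pairwise disjoint, both parts of the theorem
become statements about finite sets.

Skeletons.  Removing the top [s] from [[r, s]] leaves the disjoint union of the
intervals [[r + v_1 + ... + v_(j-1), s - v_j]], where [v_1, v_2, ...] are the
vertices of [s] outside [r]; this is the shelling of the remaining facets, each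
of them deprived of its intersection with the earlier ones
([interval_difference]).  Repeating this until all tops have cardinality [k]
partitions the members of [[r, s]] of cardinality at most [k]
([interval_truncation]).

Barycentric subdivision.  The open simplex of [Sd K] spanned by the barycenters
of a chain lies in the open simplex of [K] whose vertex set is the largest
member of the chain ([relint_chain_top]).  Hence one has to partition, into
intervals whose tops are complete flags of [s], the chains of nonempty sets whose
largest member is in [[r, s]] ([subdivided_interval]).  This is done by
induction on [s], using that the subdivision of [s] is a cone over the
subdivision of its boundary.  The boundary is cut into intervals
[[a, t]], with [t] a facet of [s], that are either inside or outside [[r, s]]
([facet_decomposition]), and the chains with largest member in [[a, t]] are
partitioned by induction.  An interval [[R, C]] of chains of the boundary
inside [[r, s]] is replaced by [[R, C + s]], since adding [s] to such a chain or
not gives a chain with largest member in [[r, s]]; an interval outside gives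
[[R + s, C + s]], since there [s] has to be added.

The geometric input is that [Sd K] is a simplicial complex with the space of [K].
In barycentric coordinates, a positive combination of the barycenters
of a chain is a positive combination of indicator functions of the members of
the chain, and these members are the superlevel sets of the sum.  So the chain
can be read off from the point ([chain_of_level_inj]), and every positive
function arises in this way ([level_decomposition]). *)

Set Implicit Arguments.
Unset Strict Implicit.
Unset Printing Implicit Defensive.

Import Order.TTheory GRing.Theory Num.Theory.

(** * Partitions into Boolean intervals *)

Section BooleanIntervals.
Local Open Scope fset_scope.
Variable V : choiceType.
Implicit Types (f g r s : {fset V}) (p : {fset V} * {fset V}).

Definition between p f : bool := (p.1 `<=` f) && (f `<=` p.2).

(** The tops all have cardinality [k], as the tiles of a tiling all have the same
dimension. *)
Definition interval_partition (k : nat) (Q : set {fset V})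
    (P : set ({fset V} * {fset V})) : Prop :=
  [/\ forall p, P p -> p.1 `<=` p.2 /\ #|` p.2| = k,
      forall f, Q f <-> exists2 p, P p & between p f
    & forall p p' f, P p -> P p' -> between p f -> between p' f -> p = p'].

Lemma between_top p : p.1 `<=` p.2 -> between p p.2.
Proof. by move=> pp; rewrite /between pp fsubset_refl. Qed.

Lemma in_some_interval (P : set ({fset V} * {fset V})) p f :
  P p -> between p f -> exists2 q, P q & between q f.
Proof. by exists p. Qed.

Lemma interval_partition_bounds k Q P p :
  interval_partition k Q P -> P p -> p.1 `<=` p.2 /\ #|` p.2| = k.
Proof. by case=> + _ _; apply. Qed.

Lemma interval_partition_cover k Q P p f :
  interval_partition k Q P -> P p -> between p f -> Q f.
Proof. by case=> _ QP _ Pp pf; apply/QP; exists p. Qed.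

(** Substitution: a family that is cut into disjoint pieces, each of which has an
interval partition, has one. *)
Lemma interval_partition_bind (A : set ({fset V} * {fset V}))
    (F : {fset V} * {fset V} -> set {fset V}) k :
  (forall q, A q -> exists P, interval_partition k (F q) P) ->
  (forall q q' f, A q -> A q' -> F q f -> F q' f -> q = q') ->
  exists P, interval_partition k [set f | exists2 q, A q & F q f]%classic P.
Proof.
move=> AF disjF.
have /choice[B BP] : forall q, exists P, A q -> interval_partition k (F q) P.
  move=> q; have [/AF[P PF]|nA] := pselect (A q); first by exists P.
  by exists set0.
exists [set p | exists2 q, A q & B q p]%classic; split.
- by move=> p [q /BP[+ _ _]]; apply.
- move=> f; split=> [[q Aq Fqf]|[p [q Aq Bqp] pf]]; last first.
    by exists q => //; apply: interval_partition_cover (BP q Aq) Bqp pf.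
  by have [_ /(_ f)/iffLR/(_ Fqf)[p Bp pf] _] := BP q Aq; exists p => //; exists q.
- move=> p p' f [q Aq Bqp] [q' Aq' Bqp'] pf pf'.
  have Fqf := interval_partition_cover (BP q Aq) Bqp pf.
  have Fqf' := interval_partition_cover (BP q' Aq') Bqp' pf'.
  have qq' := disjF _ _ _ Aq Aq' Fqf Fqf'; subst q'.
  by have [_ _ /(_ p p' f)] := BP q Aq; apply.
Qed.

(** Induction on [r]: enlarging [r - v] to [r] adds to the difference exactly the
sets that contain [r - v] and avoid [v], which form the interval
[[r - v, s - v]] below a facet of [s].  The case [r = s] is the shelling of the
boundary of a tile. *)
Lemma interval_difference r0 r s : r0 `<=` r -> r `<=` s ->
  exists P, interval_partition #|` s|.-1
    [set f | between (r0, s) f /\ ~~ (r `<=` f)%fset]%classic P.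
Proof.
have [n] := ubnP #|` r|; elim: n r => // n IH r /ltnSE rn r0r rs.
have [/eqP rr0|] := boolP (r0 == r).
  exists set0; split => // f; split=> [[/andP[]] /=|[]//].
  by rewrite rr0 => ->.
rewrite eqEfsubset r0r /= => /fsubsetPn[v vr vr0].
have r'r : r `\ v `<=` r by apply: fsubD1set.
have vs : v \in s := fsubsetP rs _ vr.
have [||| P [Pk PQ Pd]] := IH (r `\ v).
- by apply: leq_trans rn; rewrite (cardfsD1 v r) vr.
- by rewrite fsubsetD1 r0r.
- exact: fsubset_trans rs.
have vP q : P q -> r `\ v `<=` q.2 -> False.
  move=> Pq rq; have [qq _] := Pk _ Pq.
  by have [_] := (PQ q.2).2 (in_some_interval Pq (between_top qq)); rewrite rq.
have disj q f : P q -> between q f -> between (r `\ v, s `\ v) f -> False.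
  move=> Pq /andP[_ fq] /andP[/= rf _]; apply: (vP _ Pq).
  exact: fsubset_trans fq.
exists ((r `\ v, s `\ v)%fset |` P)%classic; split.
- move=> p [-> /=|/Pk//]; split; first by apply: fsetSD.
  by rewrite (cardfsD1 v s) vs.
- move=> f; split=> [[/andP[/= r0f fs] nrf]|[p [->|Pp]]].
  + have [r'f|nr'f] := boolP (r `\ v `<=` f).
      exists (r `\ v, s `\ v); first by left.
      rewrite /between r'f /= fsubsetD1 fs; apply: contra nrf => vf.
      by rewrite -(fsetD1K vr) fsubUset fsub1set vf.
    have [|p Pp pf] := (PQ f).1; last by exists p => //; right.
    by split=> //; rewrite /between /= r0f.
  + rewrite /between /= => /andP[r'f]; rewrite fsubsetD1 => /andP[fs vf].
    split; first by rewrite /= fs (fsubset_trans _ r'f)// fsubsetD1 r0r.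
    by apply: contra vf => /fsubsetP; apply.
  + move=> pf; have [] := (PQ f).2 (in_some_interval Pp pf) => bf nrf.
    by split=> //; apply: contra nrf; apply: fsubset_trans.
- move=> p p' f [->|Pp] [->|Pp'] // pf pf'; last exact: Pd pf pf'.
    by case: (disj _ _ Pp' pf' pf).
  by case: (disj _ _ Pp pf pf').
Qed.

(** While the top [s] has more than [k] elements it does not belong to the
truncated interval, and the rest of the interval is cut into intervals below
facets of [s]. *)
Lemma interval_truncation k r s : r `<=` s -> (k <= #|` s|)%N ->
  exists P, interval_partition k
    [set f | between (r, s) f /\ (#|` f| <= k)%N]%classic P.
Proof.
have [n] := ubnP #|` s|; elim: n r s => // n IH r s /ltnSE sn rs ks.
have [sk|sk] := eqVneq k #|` s|.
  exists [set (r, s)]%classic; split.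
  - by move=> _ ->.
  - move=> f; split=> [[rsf _]|[_ -> rsf]]; first by exists (r, s).
    by split=> //; rewrite sk; apply: fsubset_leq_card; case/andP: rsf.
  - by move=> p p' f -> ->.
have {sk}ks : (k < #|` s|)%N by rewrite ltn_neqAle sk.
have [A [Ak AQ Ad]] := interval_difference rs (fsubset_refl s).
have [||P PQ] := @interval_partition_bind A
    (fun q => [set f | between q f /\ (#|` f| <= k)%N]%classic) k.
- move=> [a t] /Ak[/= ta tk]; apply: IH => //; rewrite tk.
    by case: #|` s| ks sn.
  by rewrite -ltnS (ltn_predK ks).
- by move=> q q' f Aq Aq' [qf _] [qf' _]; apply: Ad qf qf'.
exists P; congr (interval_partition k _ P): PQ.
apply/predeqP => f /=; split=> [[q Aq [qf fk]]|[rsf fk]].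
  by have [] := (AQ f).2 (in_some_interval Aq qf).
have [|q Aq qf] := (AQ f).1; last by exists q.
split=> //; apply/negP => /fsubset_leq_card.
by rewrite leqNgt (leq_ltn_trans fk ks).
Qed.

(** The boundary of [s] is first cut into the part in [[r, s]] and the part outside,
so that each of the resulting intervals lies on one side only. *)
Lemma facet_decomposition r s : r `<=` s -> s != fset0 ->
  exists A, interval_partition #|` s|.-1 [set f | (f `<` s)%fset]%classic A /\
    forall q, A q -> (r `<=` q.1) || ~~ (r `<=` q.2).
Proof.
move=> rs s0.
have [A1 [A1k A1Q A1d]] := interval_difference rs (fsubset_refl s).
have [A2 [A2k A2Q A2d]] := interval_difference (fsub0set r) rs.
have low1 q : A1 q -> r `<=` q.1.
  move=> Aq; have [qq _] := A1k _ Aq.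
  have qb : between q q.1 by rewrite /between fsubset_refl.
  by have [/andP[]] := (A1Q q.1).2 (in_some_interval Aq qb).
have up2 q : A2 q -> ~~ (r `<=` q.2).
  move=> Aq; have [qq _] := A2k _ Aq.
  by have [] := (A2Q q.2).2 (in_some_interval Aq (between_top qq)).
have disj q q' f : A1 q -> A2 q' -> between q f -> between q' f -> False.
  move=> /low1 rq /up2/negP nrq /andP[qf _] /andP[_ fq]; apply: nrq.
  exact: fsubset_trans (fsubset_trans rq qf) fq.
exists (A1 `|` A2)%classic; split; last first.
  by move=> q [/low1->//|/up2->]; rewrite orbT.
split.
- by move=> q [/A1k|/A2k].
- move=> f; rewrite /= fproperE; split.
    move=> /andP[fs nsf]; have [rf|nrf] := boolP (r `<=` f).
      have [|q Aq qf] := (A1Q f).1; first by split=> //; rewrite /between /= rf.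
      by exists q => //; left.
    have [|q Aq qf] := (A2Q f).1; first by split=> //; rewrite /between /= fsub0set.
    by exists q => //; right.
  move=> [q [Aq|Aq] qf].
    by have [/andP[/= _ ->]] := (A1Q f).2 (in_some_interval Aq qf).
  have [/andP[/= _ ->] /=] := (A2Q f).2 (in_some_interval Aq qf).
  by apply: contra; apply: fsubset_trans.
- move=> q q' f [Aq|Aq] [Aq'|Aq'] qf qf'.
  + exact: A1d qf qf'.
  + by case: (disj _ _ _ Aq Aq' qf qf').
  + by case: (disj _ _ _ Aq' Aq qf' qf).
  + exact: A2d qf qf'.
Qed.

Lemma fsubset_of_card s k : (k <= #|` s|)%N ->
  exists2 f, (f `<=` s)%fset & #|` f| = k.
Proof.
move=> ks; have [P [Pk PQ _]] := interval_truncation (fsub0set s) ks.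
have [|p Pp _] := (PQ fset0).1.
  by split; rewrite ?cardfs0// /between /= !fsub0set.
have [pp pk] := Pk _ Pp; exists p.2 => //.
by have [/andP[]] := (PQ p.2).2 (in_some_interval Pp (between_top pp)).
Qed.

End BooleanIntervals.

Lemma fsetD1_between (T : choiceType) (a : T) (x y z : {fset T}) :
  a \notin x -> between (x, a |` y)%fset z = between (x, y) (z `\ a)%fset.
Proof.
move=> ax; rewrite /between /= fsubsetD1 ax andbT; congr andb.
by rewrite fsubDset.
Qed.

Lemma fset1U_between (T : choiceType) (a : T) (x y z : {fset T}) :
  a \notin x ->
  between (a |` x, a |` y)%fset z = (a \in z) && between (x, y) (z `\ a)%fset.
Proof.
move=> ax; rewrite -fsetD1_between// /between /= fsubUset fsub1set.
by rewrite andbA.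
Qed.

(** * Chains with largest member in an interval *)

Section Chains.
Local Open Scope fset_scope.
Variable V : choiceType.
Implicit Types (f g h r s : {fset V}) (c : {fset {fset V}}).

Definition is_chain c : Prop :=
  forall g h, g \in c -> h \in c -> g `<=` h \/ h `<=` g.

(** The empty chain gets the top [fset0], so that it counts as a member of the
families below exactly when [r] is empty. *)
Definition chain_top c g : Prop :=
  g \in fset0 |` c /\ forall h, h \in c -> h `<=` g.

Definition proper_chain c : Prop := is_chain c /\ fset0 \notin c.

Definition chains_topped_between r s : set {fset {fset V}} :=
  [set c | proper_chain c /\ exists2 g, between (r, s) g & chain_top c g]%classic.

(** Used for cardinalities and their reverse order as well as for real values,
whence the arbitrary total order. *)
Lemma seq_argmin d (T : orderType d) (I : eqType) (F : I -> T) (l : seq I) :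
  l != [::] -> exists2 i, i \in l & forall j, j \in l -> (F i <= F j)%O.
Proof.
elim: l => // i l IH _; have [->|/IH[j jl jm]] := eqVneq l [::].
  by exists i => [|j]; rewrite inE ?eqxx// => /eqP->.
have [ij|ji] := leP (F i) (F j).
  exists i => [|k]; rewrite inE ?eqxx// => /predU1P[->//|/jm].
  exact: le_trans.
exists j => [|k]; first by rewrite inE jl orbT.
by rewrite inE => /predU1P[->|/jm//]; apply: ltW.
Qed.

Lemma chain_comparable c g h : is_chain c -> g \in c -> h \in c ->
  (#|` g| <= #|` h|)%N -> g `<=` h.
Proof.
move=> cc gc hc gh; have [//|hg] := cc _ _ gc hc.
by have /eqP<- : h == g by rewrite eqEfcard hg.
Qed.

Lemma sub_chain c c' : c' `<=` c -> is_chain c -> is_chain c'.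
Proof. by move=> /fsubsetP sub cc g h /sub gc /sub hc; apply: cc. Qed.

Lemma sub_proper_chain c c' : c' `<=` c -> proper_chain c -> proper_chain c'.
Proof.
move=> sub [cc c0]; split; first exact: sub_chain cc.
by apply: contra c0; apply: (fsubsetP sub).
Qed.

Lemma chain_top_exists c : is_chain c -> exists g, chain_top c g.
Proof.
move=> cc; have [->|c0] := eqVneq c fset0.
  by exists fset0; split=> [|h]; rewrite !inE.
have [|g gc gm] := @seq_argmin _ _ _ (fun g => #|` g| : nat^d) (enum_fset c).
  by rewrite -size_eq0 cardfs_eq0.
exists g; split=> [|h hc]; first by rewrite !inE gc orbT.
by apply: (chain_comparable cc) => //; apply: gm.
Qed.

Lemma chain_top_unique c g g' : chain_top c g -> chain_top c g' -> g = g'.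
Proof.
have le a b : chain_top c a -> chain_top c b -> a `<=` b.
  move=> [+ _] [_ cb]; rewrite !inE => /predU1P[->|/cb//].
  exact: fsub0set.
by move=> cg cg'; apply/eqP; rewrite eqEfsubset !le.
Qed.

(** The vertex [s] of the subdivision of [s] is the apex of a cone over the
subdivided boundary, and [c `\ s] is the part in the boundary of a chain [c].  If
its top is in [[r, s]], then [c] may or may not contain [s]; otherwise [c] has to
contain [s]. *)
Lemma subdivided_interval r s : r `<=` s ->
  exists P, interval_partition #|` s| (chains_topped_between r s) P.
Proof.
have [n] := ubnP #|` s|; elim: n r s => // n IH r s /ltnSE sn rs.
have [s0|s0] := eqVneq s fset0.
  have r0 : r = fset0 by apply/eqP; rewrite -fsubset0 -s0.
  exists [set (fset0, fset0)]%classic; split.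
  - by move=> _ -> /=; rewrite fsubset_refl s0 !cardfs0.
  - move=> c; split=> [[[cc c0] [g]]|[_ ->]].
      rewrite /between /= s0 fsubset0 => /andP[_ /eqP->] [_ ctop].
      exists (fset0, fset0) => //; rewrite /between /= fsub0set /=.
      apply/fsubsetP => h hc; have := ctop _ hc; rewrite fsubset0 => /eqP h0.
      by rewrite -h0 hc in c0.
    rewrite /between /= fsub0set fsubset0 /= => /eqP->.
    split; first by split=> [g h|]; rewrite inE.
    exists fset0; first by rewrite /between /= r0 s0 fsubset_refl.
    by split=> [|h]; rewrite !inE.
  - by move=> p p' c -> ->.
have [A [[Ak AQ Ad] Ar]] := facet_decomposition rs s0.
have s_gt0 : (0 < #|` s|)%N by rewrite cardfs_gt0.
have /choice[B BP] : forall q, exists P, A q ->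
    interval_partition #|` s|.-1 (chains_topped_between q.1 q.2) P.
  move=> q; have [Aq|nA] := pselect (A q); last by exists set0.
  have [qq qs] := Ak _ Aq.
  have [|//|P] := IH q.1 q.2; last by rewrite qs; exists P.
  by rewrite qs; case: #|` s| s_gt0 sn.
have As q f : A q -> between q f -> f `<` s.
  by move=> Aq qf; apply/AQ; exists q.
have Bs q p : A q -> B q p -> s \notin p.2.
  move=> Aq Bp; have [pp _] := interval_partition_bounds (BP q Aq) Bp.
  have [_ [g qg [_ cg]]] := interval_partition_cover (BP q Aq) Bp (between_top pp).
  apply/negP => /cg sg; have := As _ _ Aq qg.
  by rewrite fproperE sg andbF.
have Bs1 q p : A q -> B q p -> s \notin p.1.
  move=> Aq Bp; apply: contra (Bs _ _ Aq Bp).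
  by have [/fsubsetP pp _] := interval_partition_bounds (BP q Aq) Bp; apply: pp.
(* The intervals [q] outside [[r, s]] are those whose bottom does not contain
   [r]; there the apex [s] is added to the bottom as well. *)
pose lift (q : {fset V} * {fset V}) (p : {fset {fset V}} * {fset {fset V}}) :=
  (if r `<=` q.1 then p.1 else s |` p.1, s |` p.2).
have liftE q p c : A q -> B q p ->
    between (lift q p) c = ((r `<=` q.1) || (s \in c)) && between p (c `\ s).
  move=> Aq Bp; have s1 := Bs1 _ _ Aq Bp; rewrite /lift.
  case: ifP => _ /=; first by rewrite fsetD1_between//; case: p Bp s1.
  by rewrite fset1U_between//; case: p Bp s1.
exists [set p' | exists2 q, A q & exists2 p, B q p & p' = lift q p]%classic; split.
- move=> _ [q Aq [p Bp ->]].
  have [pp pk] := interval_partition_bounds (BP q Aq) Bp.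
  split; last by rewrite /= cardfsU1 (Bs q)// pk add1n prednK.
  rewrite /lift /=; case: ifP => _; last exact: fsetUS.
  exact: fsubset_trans pp (fsubsetU1 _ _).
- move=> c; split.
    move=> [cP [g rsg ctop]].
    have c'P := sub_proper_chain (fsubD1set c s) cP.
    have [g' c'top] := chain_top_exists c'P.1.
    have /AQ[q Aq qg'] : g' `<` s.
      have [g'in _] := c'top; move: g'in.
      rewrite !inE => /predU1P[->|/andP[g's g'c]].
        by rewrite fproperE fsub0set fsubset0.
      rewrite fproperEneq g's /=; apply: fsubset_trans (ctop.2 _ g'c) _.
      by case/andP: rsg.
    have [p Bp pc'] : exists2 p, B q p & between p (c `\ s).
      by have [_ /(_ (c `\ s))/iffLR + _] := BP q Aq; apply; split => //; exists g'.
    exists (lift q p); first by exists q => //; exists p.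
    rewrite liftE// pc' andbT; have /orP[->//|nrq] := Ar _ Aq.
    have [//|sc] := boolP (s \in c); first by rewrite orbT.
    rewrite (mem_fsetD1 sc) in c'top.
    have gg' := chain_top_unique ctop c'top; subst g'.
    case/andP: rsg => /= rg _; case/andP: qg' => _ gq.
    by rewrite (fsubset_trans rg gq) in nrq.
  move=> [_ [q Aq [p Bp ->]]]; rewrite liftE// => /andP[rsc pc'].
  have [[c'c c'0] [g qg [gtop c'g]]] :=
    interval_partition_cover (BP q Aq) Bp pc'.
  have gs := As _ _ Aq qg.
  have c's h : h \in c -> h `<=` s.
    have [->//|hs hc] := eqVneq h s.
    apply: fsubset_trans (fproper_sub gs); apply: c'g.
    by rewrite !inE hs.
  split; first split.
  + move=> h h' hc hc'; have [hs|hs] := eqVneq h s.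
      by right; rewrite hs c's.
    have [hs'|hs'] := eqVneq h' s; first by left; rewrite hs' c's.
    by apply: c'c; rewrite !inE ?hs ?hs'.
  + by apply: contra c'0 => c0; rewrite !inE c0 eq_sym s0.
  have [sc|sc] := boolP (s \in c).
    exists s; first by rewrite /between /= rs fsubset_refl.
    by split; rewrite // !inE sc orbT.
  exists g; last by rewrite -(mem_fsetD1 sc).
  move: rsc; rewrite (negPf sc) orbF => rq.
  rewrite /between /= (fproper_sub gs) andbT.
  by apply: fsubset_trans rq _; case/andP: qg.
- move=> _ _ c [q Aq [p Bp ->]] [q' Aq' [p' Bp' ->]].
  rewrite !liftE// => /andP[_ pc] /andP[_ pc'].
  have [_ [g qg gtop]] := interval_partition_cover (BP q Aq) Bp pc.
  have [_ [g' qg' gtop']] := interval_partition_cover (BP q' Aq') Bp' pc'.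
  have gg' := chain_top_unique gtop gtop'; subst g'.
  have qq' : q = q' by apply: (Ad q q' g).
  subst q'; congr lift.
  by have [_ _ /(_ p p' (c `\ s))] := BP q Aq; apply.
Qed.

End Chains.

(** * Positive combinations of indicator functions of a chain *)

Section Levels.
Local Open Scope fset_scope.
Local Open Scope ring_scope.
Variables (R : realFieldType) (V : choiceType).
Implicit Types (f g h s : {fset V}) (c : {fset {fset V}}) (mu : {fset V} -> R).

(** For positive [mu] on a chain, this function of [v] determines the chain: its
members are superlevel sets. *)
Definition level c mu v : R := \sum_(g <- c | v \in g) mu g.

Lemma sum_fsubset (M : zmodType) (f s : {fset V}) (F : V -> M) : (f `<=` s)%fset ->
  \sum_(v <- s | v \in f) F v = \sum_(v <- f) F v.
Proof.
move=> fs; rewrite big_mkcond /= -(big_fset_incl _ fs) => [|v _ /negPf->//].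
by apply: eq_big_seq => v ->.
Qed.

(** Exchange of sums: coordinates with respect to vertices against coefficients
with respect to the members of the chain. *)
Lemma level_sum (M : lmodType R) (F : V -> M) c mu s :
  (forall g, g \in c -> (g `<=` s)%fset) ->
  \sum_(v <- s) level c mu v *: F v = \sum_(g <- c) mu g *: \sum_(v <- g) F v.
Proof.
move=> cs; under eq_bigr => v _ do rewrite scaler_suml.
rewrite (exchange_big_dep predT) //=; apply: eq_big_seq => g gc.
by rewrite -scaler_sumr sum_fsubset // cs.
Qed.

Lemma level_le c mu u v : (forall g, g \in c -> 0 < mu g) ->
  (forall g, g \in c -> u \in g -> v \in g) -> level c mu u <= level c mu v.
Proof.
move=> mu0 uv; rewrite /level big_mkcond [leRHS]big_mkcond /=.
rewrite big_seq [leRHS]big_seq; apply: ler_sum => g gc.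
case: ifP => [/(uv _ gc)->//|_].
by case: ifP => // _; apply/ltW/mu0.
Qed.

(** Every member of the chain that contains [u] contains [g], hence [v]; and [g]
itself contributes to the value at [v] only. *)
Lemma level_lt c mu g u v : is_chain c -> (forall g, g \in c -> 0 < mu g) ->
  g \in c -> v \in g -> u \notin g -> level c mu u < level c mu v.
Proof.
move=> cc mu0 gc vg ug; rewrite /level big_mkcond [ltRHS]big_mkcond /=.
rewrite (big_fsetD1 g)// [ltRHS](big_fsetD1 g)//= vg (negPf ug).
apply: ltr_leD; first exact: mu0.
rewrite big_seq [leRHS]big_seq; apply: ler_sum => h.
rewrite !inE => /andP[_ hc]; case: ifP => [uh|_]; last first.
  by case: ifP => // _; apply/ltW/mu0.
have [/fsubsetP gh|/fsubsetP hg] := cc _ _ gc hc; first by rewrite gh.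
by rewrite hg in ug.
Qed.

Lemma level_notin c mu v : (forall g, g \in c -> v \notin g) -> level c mu v = 0.
Proof.
by move=> vc; rewrite /level big_seq_cond big1 // => g /andP[/vc/negPf->].
Qed.

Lemma level_gt0 c mu g v : (forall g, g \in c -> 0 < mu g) ->
  g \in c -> v \in g -> 0 < level c mu v.
Proof.
move=> mu0 gc vg; rewrite /level big_mkcond (big_fsetD1 g)//= vg.
apply: ltr_wpDr; last exact: mu0.
rewrite big_seq; apply: sumr_ge0 => h; rewrite !inE => /andP[_ hc].
by case: ifP => // _; apply/ltW/mu0.
Qed.

(** Let [v] minimize the level on a member [g] of [c].  Then [g] is the smallest
member [H] of [c'] that contains [v]: a vertex of [g] outside [H] would have a
lower level than [v], by [level_lt] in [c'], and a vertex of [H] outside [g]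
would have at least the level of [v], against [level_lt] in [c]. *)
Lemma sub_chain_of_level c c' mu mu' : proper_chain c -> is_chain c' ->
  (forall g, g \in c -> 0 < mu g) -> (forall g, g \in c' -> 0 < mu' g) ->
  level c mu =1 level c' mu' -> (c `<=` c')%fset.
Proof.
move=> [cc c0] cc' mu0 mu'0 eqc; apply/fsubsetP => g gc.
have g0 : enum_fset g != [::].
  by rewrite -size_eq0 cardfs_eq0; apply: contra c0 => /eqP<-.
have [v vg vmin] := seq_argmin (level c mu) g0.
pose d := [fset h in c' | v \in h]%fset.
have d0 : enum_fset d != [::].
  rewrite -size_eq0 cardfs_eq0; apply/eqP => d0.
  have := level_gt0 mu0 gc vg; rewrite eqc level_notin ?ltxx// => h hc'.
  by apply/negP => vh; have : h \in fset0 by rewrite -d0 !inE hc'.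
have [H + Hmin] := seq_argmin (fun h => #|` h|) d0.
rewrite !inE => /andP[Hc' vH].
suff -> : g = H by [].
apply/eqP; rewrite eqEfsubset; apply/andP; split; apply/fsubsetP => u.
  move=> ug; apply: contraT => uH; have := vmin _ ug.
  by rewrite !eqc leNgt (level_lt _ _ Hc').
move=> uH; apply: contraT => ug.
have := level_lt cc mu0 gc vg ug; rewrite !eqc ltNge level_le// => h hc' vh.
have /fsubsetP-> // : (H `<=` h)%fset.
by apply: (chain_comparable cc') => //; apply: Hmin; rewrite !inE hc'.
Qed.

Lemma chain_of_level_inj c c' mu mu' : proper_chain c -> proper_chain c' ->
  (forall g, g \in c -> 0 < mu g) -> (forall g, g \in c' -> 0 < mu' g) ->
  level c mu =1 level c' mu' -> c = c'.
Proof.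
move=> cP c'P mu0 mu'0 eqc; apply/eqP; rewrite eqEfsubset.
rewrite (sub_chain_of_level cP c'P.1 mu0 mu'0)//.
exact: (sub_chain_of_level c'P cP.1 mu'0 mu0).
Qed.

(** Linear independence follows from the uniqueness of the chain: the members of
positive and those of negative weight would be two chains with equal levels. *)
Lemma level_eq0 c mu : proper_chain c -> (forall v, level c mu v = 0) ->
  forall g, g \in c -> mu g = 0.
Proof.
move=> cP lev0.
pose cp := [fset g in c | 0 < mu g]%fset; pose cn := [fset g in c | mu g < 0]%fset.
have cpc : (cp `<=` c)%fset by apply/fsubsetP => g; rewrite !inE => /andP[].
have cnc : (cn `<=` c)%fset by apply/fsubsetP => g; rewrite !inE => /andP[].
have cpn : cp = cn.
  apply: (@chain_of_level_inj _ _ mu (fun g => - mu g)).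
  - exact: sub_proper_chain cP.
  - exact: sub_proper_chain cP.
  - by move=> g; rewrite !inE => /andP[].
  - by move=> g; rewrite !inE oppr_gt0 => /andP[].
  - move=> v; apply/eqP; rewrite -subr_eq0 -(lev0 v) /level sumrN opprK.
    rewrite big_mkcond [X in _ + X]big_mkcond [X in _ == X]big_mkcond /=.
    rewrite !big_fset /= [X in X + _]big_mkcond [X in _ + X]big_mkcond /=.
    rewrite -big_split /=; apply/eqP/eq_bigr => g _.
    by case: ltgtP => [||<-]; rewrite ?addr0 ?add0r ?if_same.
move=> g gc; case: (ltgtP 0 (mu g)) => // g0.
  have : g \in cn by rewrite -cpn !inE gc.
  by rewrite !inE gc ltNge ltW.
have : g \in cp by rewrite cpn !inE gc.
by rewrite !inE gc ltNge ltW.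
Qed.

(** Induction on [s]: give [s] the minimum of [w] as its weight, subtract this
constant from [w], and go on with the vertices where the remainder is positive. *)
Lemma level_decomposition s (w : V -> R) : (forall v, v \in s -> 0 < w v) ->
  exists c mu, [/\ proper_chain c, chain_top c s,
    forall g, g \in c -> 0 < mu g & forall v, v \in s -> level c mu v = w v].
Proof.
have [n] := ubnP #|` s|; elim: n s w => // n IH s w /ltnSE sn w0.
have [->|s0] := eqVneq s fset0.
  exists fset0, (fun=> 1); split; [split=> [g h|]|split=> [|h]|move=> g|move=> v];
    by rewrite ?inE.
have [v0 v0s v0m] : exists2 v, v \in s & forall u, u \in s -> w v <= w u.
  by apply: seq_argmin; rewrite -size_eq0 cardfs_eq0.
(* [v0] is in [s] but not in [s'], so [s'] is smaller. *)
pose s' := [fset v in s | w v0 < w v]%fset.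
have s's : (s' `<=` s)%fset by apply/fsubsetP => v; rewrite !inE => /andP[].
have v0s' : v0 \notin s' by rewrite !inE ltxx andbF.
have [||c [mu [[cc c0] [_ cs'] mu0 cw]]] := IH s' (fun v => w v - w v0).
- apply: leq_trans sn; apply: fproper_ltn_card.
  by rewrite fproperE s's; apply/fsubsetPn; exists v0.
- by move=> v; rewrite !inE subr_gt0 => /andP[].
have sc : s \notin c.
  by apply/negP => /cs' /fsubsetP/(_ _ v0s); rewrite (negPf v0s').
have cs h : h \in c -> (h `<=` s)%fset by move=> /cs' hs'; apply: fsubset_trans s's.
exists (s |` c)%fset, (fun g => if g == s then w v0 else mu g); split.
- split; last by rewrite !inE negb_or eq_sym s0.
  move=> g h; rewrite !inE => /predU1P[->|gc] /predU1P[->|hc].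
  + by left.
  + by right; apply: cs.
  + by left; apply: cs.
  + exact: cc.
- by split=> [|h]; rewrite !inE ?eqxx ?orbT// => /predU1P[->//|/cs].
- move=> g; rewrite !inE => /predU1P[->|gc]; first by rewrite eqxx w0.
  by case: ifP => [_|_]; rewrite ?w0 ?mu0.
- move=> v vs; rewrite /level big_mkcond big_fsetU1//= vs eqxx -big_mkcond /=.
  rewrite -[RHS](subrKC (w v0)); congr (_ + _).
  transitivity (level c mu v).
    rewrite /level big_seq_cond [RHS]big_seq_cond; apply: eq_bigr => g.
    by move=> /andP[gc _]; case: eqP => // gs; rewrite -gs gc in sc.
  have [vs'|vs'] := boolP (v \in s'); first exact: cw.
  rewrite level_notin; last first.
    by move=> g /cs'/fsubsetP gs'; apply: contra vs'; apply: gs'.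
  apply/eqP; rewrite eq_sym subr_eq0 eq_le v0m// andbT leNgt.
  by apply: contra vs'; rewrite !inE vs.
Qed.

End Levels.

(** * Relative interiors, and tiles as Boolean intervals *)

Section Geometry.
Local Open Scope fset_scope.
Local Open Scope classical_set_scope.
Local Open Scope ring_scope.
Context {R : realType} {E : lmodType R}.
Implicit Types (s f g : {fset E}) (c : {fset {fset E}}) (K X : set {fset E}).
Implicit Types (p : {fset E} * {fset E}) (x : E).

Definition relint f : set E :=
  [set x | exists w : E -> R,
    [/\ forall v, v \in f -> 0 < w v,
        \sum_(v <- f) w v = 1
      & x = \sum_(v <- f) w v *: v]].

(** The cell of the pair [(r, s)] is the simplex [s] deprived of its facets opposite
to the vertices of [r]; see [cell_facets]. *)
Definition cell p : set E := [set x | exists2 f, between p f & relint f x].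

Lemma sum_extend (M : lmodType R) (w : E -> R) (F : E -> M) f s :
  (f `<=` s)%fset ->
  \sum_(v <- s) (if v \in f then w v else 0) *: F v = \sum_(v <- f) w v *: F v.
Proof.
move=> fs; rewrite -(sum_fsubset (fun v => w v *: F v) fs) [RHS]big_mkcond /=.
by apply: eq_bigr => v _; case: ifP => // _; rewrite scale0r.
Qed.

Lemma sum_extend1 (w : E -> R) f s : (f `<=` s)%fset ->
  \sum_(v <- s) (if v \in f then w v else 0) = \sum_(v <- f) w v.
Proof. by move=> fs; rewrite -(sum_fsubset w fs) [RHS]big_mkcond. Qed.

Lemma affine_coordinates_unique s (w w' : E -> R) : affinely_independent s ->
  \sum_(v <- s) w v = \sum_(v <- s) w' v ->
  \sum_(v <- s) w v *: v = \sum_(v <- s) w' v *: v ->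
  forall v, v \in s -> w v = w' v.
Proof.
move=> sI e ev v vs; apply/eqP; rewrite -subr_eq0; apply/eqP.
apply: (sI (fun v => w v - w' v)) vs.
  by rewrite sumrB e subrr.
by under eq_bigr do rewrite scalerBl; rewrite sumrB ev subrr.
Qed.

Lemma conv_sub f s : (f `<=` s)%fset -> conv f `<=` conv s.
Proof.
move=> fs x [w [w0 w1 ->]].
exists (fun v => if v \in f then w v else 0); split.
- by move=> v _; case: ifP => // /w0.
- by rewrite sum_extend1.
- by rewrite (sum_extend w id fs).
Qed.

Lemma relint_conv f : relint f `<=` conv f.
Proof. by move=> x [w [w0 w1 ->]]; exists w; split=> // v /w0/ltW. Qed.

Lemma relint_neq0 f x : relint f x -> f != fset0.
Proof.
move=> [w [_ w1 _]]; apply/eqP => f0; move/eqP: w1.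
by rewrite f0 big_seq_fset0 eq_sym oner_eq0.
Qed.

Lemma conv_relint s x : conv s x -> exists2 f, (f `<=` s)%fset & relint f x.
Proof.
move=> [w [w0 w1 ->]]; pose f := [fset v in s | 0 < w v]%fset.
have fs : (f `<=` s)%fset by apply/fsubsetP => v; rewrite !inE => /andP[].
have wf v : v \in s -> v \notin f -> w v = 0.
  move=> vs; rewrite !inE vs /= -leNgt => wv; apply/eqP.
  by rewrite eq_le wv w0.
exists f => //; exists w; split.
- by move=> v; rewrite !inE => /andP[].
- by rewrite (big_fset_incl _ fs).
- by rewrite (big_fset_incl _ fs)// => v vs vf; rewrite wf ?scale0r.
Qed.

(** By uniqueness of coordinates, the support of a point is contained in every
face whose hull contains the point. *)
Lemma relint_min s f g x : affinely_independent s ->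
  (f `<=` s)%fset -> (g `<=` s)%fset -> relint f x -> conv g x -> (f `<=` g)%fset.
Proof.
move=> sI fs gs [w [w0 w1 xw]] [u [_ u1 xu]]; apply/fsubsetP => v vf.
have := @affine_coordinates_unique s (fun v => if v \in f then w v else 0)
  (fun v => if v \in g then u v else 0) sI.
rewrite !sum_extend1// (sum_extend w id fs) (sum_extend u id gs) w1 u1.
move=> /(_ erefl); rewrite -xw -xu => /(_ erefl v (fsubsetP fs _ vf)).
by rewrite vf; case: ifP => // _ wv; have := w0 _ vf; rewrite wv ltxx.
Qed.

Lemma relint_barycenter f : f != fset0 -> relint f (barycenter f).
Proof.
move=> f0; have nf : #|` f|%:R != 0 :> R by rewrite pnatr_eq0 cardfs_eq0.
exists (fun=> #|` f|%:R^-1); split.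
- by move=> v _; rewrite invr_gt0 ltr0n cardfs_gt0.
- rewrite big_const_seq count_predT iter_addr_0 -[X in X *+ _]mul1r -mulrnAr.
  by rewrite -mulr_natl mulfV// mulr1.
- by rewrite /barycenter scaler_sumr.
Qed.

Lemma relint_disjoint K f g x : simplicial_complex K -> K f -> K g ->
  relint f x -> relint g x -> f = g.
Proof.
case=> KI _ Kcap.
have le a b : K a -> K b -> relint a x -> relint b x -> (a `<=` b)%fset.
  move=> Ka Kb ax bx; have [_ aI] := KI _ Ka.
  have : (a `<=` a `&` b)%fset.
    apply: (relint_min aI _ _ ax) => //; first exact: fsubsetIl.
    by rewrite -Kcap//; split; apply: relint_conv.
  by rewrite fsubsetI => /andP[].
by move=> Kf Kg fx gx; apply/eqP; rewrite eqEfsubset !le.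
Qed.

(** A point common to two simplices lies in the relative interior of a face of
each; if relative interiors are disjoint these faces coincide, and so they are a
face of the intersection.  This replaces the condition on hulls by one that is
easy to check for subdivisions. *)
Lemma simplicial_complex_of_disjoint K :
  (forall s, K s -> s != fset0 /\ affinely_independent s) ->
  (forall s f, K s -> f != fset0 -> (f `<=` s)%fset -> K f) ->
  (forall f g x, K f -> K g -> relint f x -> relint g x -> f = g) ->
  simplicial_complex K.
Proof.
move=> KI Kface Kdisj; split=> // s s' Ks Ks'; apply/seteqP; split=> x.
  move=> [/conv_relint[f fs fx] /conv_relint[g gs' gx]].
  have fg : f = g.
    by apply: (Kdisj _ _ _ _ _ fx gx); [apply: (Kface s)|apply: (Kface s')];
      rewrite ?(relint_neq0 fx) ?(relint_neq0 gx).
  apply: (@conv_sub f); last exact: relint_conv.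
  by rewrite fsubsetI fs fg.
by move=> ssx; split; apply: conv_sub ssx; rewrite ?fsubsetIl ?fsubsetIr.
Qed.

Lemma spaceP K x : simplicial_complex K ->
  Defs.space K x <-> exists2 f, K f & relint f x.
Proof.
move=> [_ Kface _]; split=> [[s Ks /conv_relint[f fs fx]]|[f Kf fx]].
  by exists f => //; apply: (Kface s) => //; apply: relint_neq0 fx.
by exists f => //; apply: relint_conv.
Qed.

Lemma cell_relint K p f x : simplicial_complex K -> K p.2 -> K f -> relint f x ->
  cell p x <-> between p f.
Proof.
move=> KC Kp Kf fx; split=> [[g pg gx]|]; last by exists f.
have [_ Kface _] := KC.
suff -> : f = g by [].
apply: (relint_disjoint KC Kf _ fx gx); apply: Kface Kp _ _.
  exact: relint_neq0 gx.
by case/andP: pg.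
Qed.

(** For a point in the relative interior of a face [f], lying outside the facet
opposite to [v] means that [f] contains [v]. *)
Lemma cell_facets s r c : affinely_independent s -> (r `<=` s)%fset ->
  (forall f, f \in c <-> exists2 v, v \in r & f = (s `\ v)%fset) ->
  conv s `\` \bigcup_(f in [set` c]) conv f = cell (r, s).
Proof.
move=> sI rs cE; apply/seteqP; split=> x.
  move=> [/conv_relint[f fs fx] xc]; exists f => //.
  rewrite /between /= fs andbT; apply/fsubsetP => v vr.
  apply: contraT => vf; case: xc; exists (s `\ v)%fset.
    by apply/cE; exists v.
  by apply: (@conv_sub f); [rewrite fsubsetD1 fs|apply: relint_conv].
move=> [f /andP[/= rf fs] fx]; split.
  by apply: (conv_sub fs); apply: relint_conv.
move=> [_ /cE[v vr ->] gx].
have := relint_min sI fs (fsubD1set s v) fx gx.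
by rewrite fsubsetD1 (fsubsetP rf _ vr) andbF.
Qed.

Lemma is_facetP s f : is_facet s f <-> exists2 v, v \in s & f = (s `\ v)%fset.
Proof.
split=> [[fs sf]|[v vs ->]]; last first.
  by split; [apply: fsubD1set|rewrite (cardfsD1 v s) vs].
have /fsubsetPn[v vs vf] : ~~ (s `<=` f)%fset.
  by apply/negP => /fsubset_leq_card; rewrite sf ltnn.
exists v => //; apply/eqP; rewrite eqEfcard fsubsetD1 fs vf /=.
by move: sf; rewrite (cardfsD1 v s) vs add1n => -[->].
Qed.

Lemma cell_of_tile X m k t : simplicial_complex X -> is_tile X m k t ->
  exists p, [/\ X p.2, #|` p.2| = m.+1, (p.1 `<=` p.2)%fset & t = cell p].
Proof.
move=> [XI _ _] [s [c [[Xs sm] [cf _] ->]]].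
exists ([fset v in s | (s `\ v)%fset \in c]%fset, s).
have rs : ([fset v in s | (s `\ v)%fset \in c] `<=` s)%fset.
  by apply/fsubsetP => v; rewrite !inE => /andP[].
split=> //; apply: cell_facets => //; first by case: (XI _ Xs).
move=> f; split=> [fc|[v + ->]]; last by rewrite !inE => /andP[].
have [v vs fE] := (is_facetP s f).1 (cf _ fc).
by exists v => //; rewrite !inE vs -fE.
Qed.

Lemma tile_of_cell X m p : simplicial_complex X -> X p.2 -> #|` p.2| = m.+1 ->
  (p.1 `<=` p.2)%fset -> is_tile X m #|` p.1| (cell p).
Proof.
case: p => r s /= [XI _ _] Xs sm rs.
exists s, [fset (s `\ v)%fset | v in r]%fset.
have cE f : f \in [fset (s `\ v)%fset | v in r]%fset <->
    exists2 v, v \in r & f = (s `\ v)%fset.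
  by split=> [/imfsetP[v /= vr ->]|[v vr ->]]; [exists v|apply/imfsetP; exists v].
split=> //; last by rewrite (cell_facets _ rs cE)//; case: (XI _ Xs).
split=> [f /cE[v vr ->]|].
  by apply/is_facetP; exists v => //; apply: (fsubsetP rs).
rewrite card_in_imfset// => u v ur vr uv.
have : u \notin (s `\ v)%fset by rewrite -uv !inE eqxx.
by rewrite !inE (fsubsetP rs _ ur) andbT negbK => /eqP.
Qed.

End Geometry.

(** * The barycentric subdivision as a simplicial complex *)

Section BarycentricSubdivision.
Local Open Scope fset_scope.
Local Open Scope classical_set_scope.
Local Open Scope ring_scope.
Context {R : realType} {E : lmodType R}.
Implicit Types (s f g : {fset E}) (c : {fset {fset E}}) (x : E).
Variable K : set {fset E}.
Hypothesis KC : simplicial_complex K.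

Definition barycenters c : {fset E} := [fset barycenter s | s in c]%fset.

Definition chain_in c : Prop := is_chain c /\ forall s, s \in c -> K s.

Lemma SdP b : Sd K b <-> exists c, [/\ c != fset0, chain_in c & b = barycenters c].
Proof.
by split=> [[c [c0 cK cc ->]]|[c [c0 [cc cK] ->]]]; exists c.
Qed.

Lemma chain_in_neq0 c g : chain_in c -> g \in c -> g != fset0.
Proof. by move=> [_ cK] /cK Kg; have [KI _ _] := KC; case: (KI _ Kg). Qed.

Lemma proper_chain_in c : chain_in c -> proper_chain c.
Proof.
move=> [cc cK]; split=> //; apply/negP => c0.
by have := chain_in_neq0 (conj cc cK) c0; rewrite eqxx.
Qed.

Lemma chain_in_sub c s : K s -> proper_chain c ->
  (forall g, g \in c -> (g `<=` s)%fset) -> chain_in c.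
Proof.
move=> Ks [cc c0] cs; split=> // g gc; have [_ Kface _] := KC.
apply: (Kface s) => //; last exact: cs.
by apply: contra c0 => /eqP<-.
Qed.

Lemma chain_in_top c s : c != fset0 -> chain_in c -> chain_top c s -> s \in c.
Proof.
move=> /fset0Pn[g gc] cK [+ cs]; rewrite !inE => /predU1P[s0|//].
by have := cs _ gc; rewrite s0 fsubset0 (negPf (chain_in_neq0 cK gc)).
Qed.

Lemma barycenter_inj s s' : K s -> K s' -> barycenter s = barycenter s' -> s = s'.
Proof.
have [KI _ _] := KC; move=> Ks Ks' ss'.
apply: (relint_disjoint KC Ks Ks' (relint_barycenter (KI _ Ks).1)).
by rewrite ss'; apply: relint_barycenter (KI _ Ks').1.
Qed.

Lemma barycenter_inj_in c : chain_in c ->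
  {in c &, injective (@barycenter R E)}.
Proof. by move=> [_ cK] s s' /cK Ks /cK Ks'; apply: barycenter_inj. Qed.

Lemma mem_barycenters c s : chain_in c -> K s ->
  (barycenter s \in barycenters c) = (s \in c).
Proof.
move=> [_ cK] Ks; apply/imfsetP/idP => [[s' /= s'c]|sc]; last by exists s.
by move=> /(barycenter_inj Ks (cK _ s'c)) ->.
Qed.

Lemma barycenters_sub c c' : chain_in c -> chain_in c' ->
  (barycenters c `<=` barycenters c')%fset = (c `<=` c')%fset.
Proof.
move=> cK c'K; apply/fsubsetP/fsubsetP => [sub s sc|sub _ /imfsetP[s /= sc ->]].
  have Ks := cK.2 _ sc; rewrite -(mem_barycenters c'K Ks).
  by apply: sub; rewrite mem_barycenters.
by apply/imfsetP; exists s => //; apply: sub.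
Qed.

Lemma card_barycenters c : chain_in c -> #|` barycenters c| = #|` c|.
Proof. by move=> cK; rewrite card_in_imfset//; apply: barycenter_inj_in. Qed.

(** The barycenter of [g] gives each vertex of [g] the coordinate [1 / #|g|], so this
is what a weight at the barycenter contributes to each vertex. *)
Definition scaled_weight (w : E -> R) g : R := w (barycenter g) / #|` g|%:R.

Lemma scaled_weightK w c g : chain_in c -> g \in c ->
  scaled_weight w g * #|` g|%:R = w (barycenter g).
Proof.
move=> cK gc.
by rewrite /scaled_weight divfK// pnatr_eq0 cardfs_eq0 (chain_in_neq0 cK gc).
Qed.

(** A combination of the barycenters of a chain has the levels of the scaled
weights as its coordinates in the simplex [s]. *)
Lemma sum_barycenters c s (w : E -> R) : chain_in c ->
  (forall g, g \in c -> (g `<=` s)%fset) ->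
  \sum_(b <- barycenters c) w b = \sum_(v <- s) level c (scaled_weight w) v /\
  \sum_(b <- barycenters c) w b *: b =
    \sum_(v <- s) level c (scaled_weight w) v *: v.
Proof.
move=> cK cs; have inj := barycenter_inj_in cK.
rewrite /barycenters; split; last first.
  rewrite big_imfset /=; last exact: inj.
  rewrite (level_sum id _ cs); apply: eq_bigr => g _.
  by rewrite /barycenter scalerA.
rewrite big_imfset /=; last exact: inj.
(* The sum of the coordinates is [level_sum] for the constant function 1 with
   values in the regular module. *)
transitivity (\sum_(v <- s) level c (scaled_weight w) v *: (1 : R^o)); last first.
  by apply: eq_bigr => v _; rewrite /GRing.scale /= mulr1.
rewrite (level_sum (fun=> 1 : R^o) _ cs); apply: eq_big_seq => g gc.
rewrite big_const_seq count_predT iter_addr_0 -(scaled_weightK w cK gc).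
by [].
Qed.

Lemma relint_barycenters c s x : c != fset0 -> chain_in c -> chain_top c s ->
  relint (barycenters c) x ->
  exists mu, [/\ forall g, g \in c -> 0 < mu g,
    \sum_(v <- s) level c mu v = 1 & x = \sum_(v <- s) level c mu v *: v].
Proof.
move=> c0 cK cs [w [w0 w1 ->]].
have [s1 s2] := sum_barycenters w cK cs.2.
exists (scaled_weight w); split; rewrite -?s1 -?s2// => g gc.
apply: divr_gt0; first by apply: w0; apply/imfsetP; exists g.
by rewrite ltr0n cardfs_gt0 (chain_in_neq0 cK gc).
Qed.

(** The largest member [s] of the chain contributes a positive amount to each of
its vertices. *)
Lemma relint_chain_top c s x : c != fset0 -> chain_in c -> chain_top c s ->
  relint (barycenters c) x -> relint s x.
Proof.
move=> c0 cK cs /(relint_barycenters c0 cK cs)[mu [mu0 mu1 ->]].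
exists (level c mu); split=> // v vs.
exact: (level_gt0 mu0 (chain_in_top c0 cK cs) vs).
Qed.

(** The largest members of both chains are the simplex of [K] whose relative
interior contains the point.  In that simplex the coordinates of the point are
unique, and they determine the chain. *)
Lemma relint_barycenters_inj c c' x : c != fset0 -> c' != fset0 ->
  chain_in c -> chain_in c' ->
  relint (barycenters c) x -> relint (barycenters c') x -> c = c'.
Proof.
move=> c0 c'0 cK c'K cx c'x.
have [s cs] := chain_top_exists cK.1; have [s' c's'] := chain_top_exists c'K.1.
have Ks := cK.2 _ (chain_in_top c0 cK cs).
have Ks' := c'K.2 _ (chain_in_top c'0 c'K c's').
have ss' : s = s'.
  apply: (relint_disjoint KC Ks Ks' (relint_chain_top c0 cK cs cx)).
  exact: (relint_chain_top c'0 c'K c's' c'x).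
subst s'.
have [mu [mu0 mu1 xmu]] := relint_barycenters c0 cK cs cx.
have [mu' [mu'0 mu'1 xmu']] := relint_barycenters c'0 c'K c's' c'x.
apply: (chain_of_level_inj (proper_chain_in cK) (proper_chain_in c'K) mu0 mu'0) => v.
have [vs|vs] := boolP (v \in s).
  have [KI _ _] := KC; apply: (affine_coordinates_unique (KI _ Ks).2) => //.
    by rewrite mu1 mu'1.
  by rewrite -xmu -xmu'.
by rewrite !level_notin// => g gc; apply: contra vs; apply/fsubsetP;
  [apply: c's'.2|apply: cs.2].
Qed.

Lemma affinely_independent_barycenters c : c != fset0 -> chain_in c ->
  affinely_independent (barycenters c).
Proof.
move=> c0 cK w w0 w0v _ /imfsetP[g /= gc ->].
have [s cs] := chain_top_exists cK.1.
have [s1 s2] := sum_barycenters w cK cs.2.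
have [KI _ _] := KC.
have sI := (KI _ (cK.2 _ (chain_in_top c0 cK cs))).2.
rewrite -(scaled_weightK w cK gc).
rewrite (level_eq0 (proper_chain_in cK) _ gc) ?mul0r// => v.
have [vs|vs] := boolP (v \in s).
  by apply: (sI (level c (scaled_weight w))); rewrite -?s1 -?s2.
by rewrite level_notin// => h hc; apply: contra vs; apply/fsubsetP; apply: cs.2.
Qed.

Lemma simplicial_complex_Sd : simplicial_complex (Sd K).
Proof.
apply: simplicial_complex_of_disjoint.
- move=> _ /SdP[c [c0 cK ->]]; split; last exact: affinely_independent_barycenters.
  by rewrite -cardfs_gt0 card_barycenters// cardfs_gt0.
- move=> _ f /SdP[c [c0 cK ->]] /fset0Pn[b bf] fc; apply/SdP.
  exists [fset g in c | barycenter g \in f]%fset.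
  have bE b' : b' \in f -> exists2 g, g \in c & b' = barycenter g.
    by move=> /(fsubsetP fc)/imfsetP[g /= gc ->]; exists g.
  split.
  + have [g gc bg] := bE _ bf; apply/fset0Pn; exists g.
    by rewrite !inE gc -bg.
  + split.
      by apply: sub_chain cK.1; apply/fsubsetP => g; rewrite !inE => /andP[].
    by move=> g; rewrite !inE => /andP[/cK.2].
  + apply/fsetP => b'; apply/idP/imfsetP => [b'f|[g /=]]; last first.
      by rewrite !inE => /andP[_ gf] ->.
    have [g gc b'g] := bE _ b'f.
    by exists g => //=; rewrite !inE gc -b'g.
- move=> _ _ x /SdP[c [c0 cK ->]] /SdP[c' [c'0 c'K ->]] cx c'x.
  by rewrite (relint_barycenters_inj c0 c'0 cK c'K cx c'x).
Qed.

(** In one direction, a point of an open simplex of [Sd K] is in the open simplex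
of the largest member of the chain; in the other, [level_decomposition] is
applied to the coordinates of a point. *)
Lemma space_Sd : Defs.space (Sd K) = Defs.space K.
Proof.
apply/seteqP; split=> x.
  move=> /(spaceP _ simplicial_complex_Sd)[_ /SdP[c [c0 cK ->]] cx].
  have [s cs] := chain_top_exists cK.1.
  apply/(spaceP _ KC); exists s; first exact/cK.2/(chain_in_top c0 cK cs).
  exact: relint_chain_top cx.
move=> /(spaceP _ KC)[s Ks [w [w0 w1 ->]]].
have [c [mu [cP cs mu0 cw]]] := level_decomposition w0.
have cK := chain_in_sub Ks cP cs.2.
have [KI _ _] := KC; have [s0 _] := KI _ Ks.
have sc : s \in c by have [+ _] := cs; rewrite !inE (negPf s0).
have c0 : c != fset0 by apply/fset0Pn; exists s.
apply/(spaceP _ simplicial_complex_Sd); exists (barycenters c).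
  by apply/SdP; exists c.
(* The weight at a barycenter has to be given as a function of the point, so
   the barycenter map is inverted on [c]. *)
have /choice[of_bary of_baryP] : forall b, exists g,
    b \in barycenters c -> g \in c /\ b = barycenter g.
  move=> b; have [/imfsetP[g gc bg]|] := boolP (b \in barycenters c).
    by exists g.
  by exists fset0.
pose w' b := mu (of_bary b) * #|` of_bary b|%:R.
have w'E g : g \in c -> w' (barycenter g) = mu g * #|` g|%:R.
  move=> gc; have [|hc gh] := of_baryP (barycenter g).
    by apply/imfsetP; exists g.
  by rewrite /w' -(barycenter_inj_in cK gc hc gh).
have lev v : level c (scaled_weight w') v = level c mu v.
  rewrite /level big_seq_cond [RHS]big_seq_cond; apply: eq_bigr => g /andP[gc _].
  by rewrite /scaled_weight w'E// mulfK// pnatr_eq0 cardfs_eq0 (chain_in_neq0 cK gc).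
have [s1 s2] := sum_barycenters w' cK cs.2.
exists w'; split.
- move=> _ /imfsetP[g /= gc ->]; rewrite w'E// mulr_gt0 ?mu0// ltr0n cardfs_gt0.
  exact: (chain_in_neq0 cK gc).
- by rewrite s1 -w1; apply: eq_big_seq => v vs; rewrite lev cw.
- by rewrite s2; apply: eq_big_seq => v vs; rewrite lev cw.
Qed.

End BarycentricSubdivision.

(** * Induced tilings *)

Section InducedTilings.
Local Open Scope fset_scope.
Local Open Scope classical_set_scope.
Local Open Scope ring_scope.
Context {R : realType} {E : lmodType R}.
Implicit Types (s f g : {fset E}) (c : {fset {fset E}}) (K X : set {fset E}).
Implicit Types (p : {fset E} * {fset E}) (x : E) (t : set E) (T : set (set E)).

(** The set [t], restricted to the space of [X], is a union of open simplices of
[X], and the simplices which occur are partitioned into intervals. *)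
Definition refined_by_intervals X (m : nat) t
    (P : set ({fset E} * {fset E})) : Prop :=
  [/\ forall p, P p -> [/\ X p.2, #|` p.2| = m.+1 & (p.1 `<=` p.2)%fset],
      forall f x, X f -> relint f x -> t x <-> exists2 p, P p & between p f
    & forall f p p', X f -> P p -> P p' -> between p f -> between p' f -> p = p'].

(** The tiles are the cells of all the intervals of all the [t].  Two cells with a
common point belong to the same [t], as [T] is a partition, and to the same
interval, as the open simplex through that point is unique. *)
Lemma induced_tiling (n m : nat) K X T : is_tiling n K T ->
  simplicial_complex X -> has_dimension X m -> Defs.space X `<=` Defs.space K ->
  (forall t, T t -> exists P, refined_by_intervals X m t P) ->
  exists T', is_tiling m X T' /\
    forall t, T t -> disjoint_union_of T' (t `&` Defs.space X).
Proof.
move=> [KC _ _ [Tcov Tdisj _]] XC Xm XK TP.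
have /choice[P PT] : forall t, exists P, T t -> refined_by_intervals X m t P.
  move=> t; have [/TP[P]|nT] := pselect (T t); first by exists P.
  by exists set0.
have [_ Xface _] := XC.
have cellP t p x : T t -> P t p -> cell p x ->
    exists f, [/\ X f, relint f x, between p f & t x].
  move=> Tt Ptp [f pf fx]; have [PX Pt _] := PT t Tt.
  have [Xp _ _] := PX _ Ptp.
  have Xf : X f.
    by apply: Xface Xp (relint_neq0 fx) _; case/andP: pf.
  by exists f; split=> //; apply/(Pt f x Xf fx); exists p.
have cellX t p x : T t -> P t p -> cell p x -> Defs.space X x.
  move=> Tt Ptp /(cellP t p x Tt Ptp)[f [Xf fx _ _]].
  by apply/(spaceP _ XC); exists f.
have pointP t x : T t -> t x -> Defs.space X x -> exists2 p, P t p & cell p x.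
  move=> Tt tx /(spaceP _ XC)[f Xf fx]; have [_ Pt _] := PT t Tt.
  by have [p Ptp pf] := (Pt f x Xf fx).1 tx; exists p => //; exists f.
have cell_inj t t' p p' x : T t -> T t' -> P t p -> P t' p' ->
    cell p x -> cell p' x -> t = t' /\ p = p'.
  move=> Tt Tt' Ptp Ptp' /(cellP _ _ _ Tt Ptp)[f [Xf fx pf tx]].
  move=> /(cellP _ _ _ Tt' Ptp')[f' [Xf' fx' pf' tx']].
  have ff' := relint_disjoint XC Xf Xf' fx fx'; subst f'.
  have tt' : t = t' by apply: Tdisj => //; exists x.
  subst t'; split=> //; have [_ _ Pinj] := PT t Tt.
  exact: Pinj Xf Ptp Ptp' pf pf'.
have cell_neq0 t p : T t -> P t p -> cell p !=set0.
  move=> Tt Ptp; have [PX _ _] := PT t Tt; have [_ pm pp] := PX _ Ptp.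
  exists (barycenter p.2); exists p.2; first by rewrite /between pp fsubset_refl.
  by apply: relint_barycenter; rewrite -cardfs_gt0 pm.
exists [set u | exists t p, [/\ T t, P t p & u = cell p]]; split.
  split=> //.
    move=> _ [t [p [Tt Ptp ->]]]; have [PX _ _] := PT t Tt.
    have [Xp pm pp] := PX _ Ptp; exists #|` p.1|; last exact: tile_of_cell.
    by rewrite -pm fsubset_leq_card.
  split.
  - apply/seteqP; split=> x.
      by move=> [_ [t [p [Tt Ptp ->]]] /(cellX t p x Tt Ptp)].
    move=> xX; have : cover T id x by rewrite Tcov; apply: XK.
    move=> [t Tt tx]; have [p Ptp px] := pointP t x Tt tx xX.
    by exists (cell p) => //; exists t, p.
  - move=> _ _ [t [p [Tt Ptp ->]]] [t' [p' [Tt' Ptp' ->]]] [x [px p'x]].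
    by have [_ ->] := cell_inj _ _ _ _ _ Tt Tt' Ptp Ptp' px p'x.
  - by move=> _ [t [p [Tt Ptp ->]]]; exact: (cell_neq0 t p).
move=> t Tt; exists [set u | exists2 p, P t p & u = cell p].
  by move=> _ [p Ptp ->]; exists t, p.
split.
- apply/seteqP; split=> x.
    move=> [_ [p Ptp ->] px]; split; last exact: (cellX t p x).
    by have [f []] := cellP _ _ _ Tt Ptp px.
  move=> [tx xX]; have [p Ptp px] := pointP t x Tt tx xX.
  by exists (cell p) => //; exists p.
- move=> _ _ [p Ptp ->] [p' Ptp' ->] [x [px p'x]].
  by have [_ ->] := cell_inj _ _ _ _ _ Tt Tt Ptp Ptp' px p'x.
- by move=> _ [p Ptp ->]; exact: (cell_neq0 t p).
Qed.

Lemma simplicial_complex_skeleton i K :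
  simplicial_complex K -> simplicial_complex (skeleton i K).
Proof.
move=> [KI Kface Kcap]; split=> [s [/KI//]|s f [Ks si] f0 fs|s s' [Ks _] [Ks' _]].
  by split; [exact: Kface Ks f0 fs|exact: leq_trans (fsubset_leq_card fs) si].
exact: Kcap.
Qed.

Lemma has_dimension_skeleton n i K : simplicial_complex K ->
  has_dimension K n -> (i <= n)%N -> has_dimension (skeleton i K) i.
Proof.
move=> [_ Kface _] [_ [s Ks sn]] ni; split=> [f []//|].
have [|f fs fi] := @fsubset_of_card _ s i.+1; first by rewrite sn.
exists f => //; split; last by rewrite fi.
by apply: Kface Ks _ fs; rewrite -cardfs_gt0 fi.
Qed.

Lemma skeleton_tiling n i K T : is_tiling n K T -> (i <= n)%N ->
  exists T', induces_on_skeleton T i K T'.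
Proof.
move=> TT ni; have [KC Kn Ttile _] := TT; have [_ Kface _] := KC.
apply: (induced_tiling TT).
- exact: simplicial_complex_skeleton.
- exact: has_dimension_skeleton ni.
- by move=> x [s [Ks _] sx]; exists s.
move=> t Tt; have [k _ /(cell_of_tile KC)[[r s] /= [Ks sn rs ->]]] := Ttile _ Tt.
have [|P [Pk PQ Pd]] := interval_truncation (k := i.+1) rs; first by rewrite sn.
exists P; split.
- move=> p Pp; have [pp pk] := Pk _ Pp; split=> //.
  have [/andP[_ /= ps] pi] := (PQ p.2).2 (in_some_interval Pp (between_top pp)).
  by split=> //; apply: Kface Ks _ ps; rewrite -cardfs_gt0 pk.
- move=> f x [Kf fi] fx; rewrite (cell_relint (p := (r, s)) KC Ks Kf fx).
  by split=> [rsf|/PQ[]//]; apply/PQ.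
- by move=> f p p' _; apply: Pd.
Qed.

Lemma chain_interval_Sd n K P r s : simplicial_complex K -> K s ->
  interval_partition n (chains_topped_between r s) P ->
  forall q, P q -> chain_in K q.1 /\ chain_in K q.2.
Proof.
move=> KC Ks PQ p Pp; have [pp _] := interval_partition_bounds PQ Pp.
have [pP [g /andP[/= _ gs] [_ pg]]] :=
  interval_partition_cover PQ Pp (between_top pp).
have ps h : h \in p.2 -> (h `<=` s)%fset by move=> /pg hg; apply: fsubset_trans gs.
split; apply: (chain_in_sub KC Ks) => //; first exact: sub_proper_chain pP.
by move=> h /(fsubsetP pp)/ps.
Qed.

(** The bound holds because a chain with top [s] extends to a complete flag of
[s], the top of the interval of [subdivided_interval] to which it belongs; a
simplex of dimension [n] comes from the top of such an interval when [s] has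
[n.+1] vertices. *)
Lemma has_dimension_Sd n K : simplicial_complex K -> has_dimension K n ->
  has_dimension (Sd K) n.
Proof.
move=> KC [Kle [s0 Ks0 s0n]]; split.
  move=> _ /SdP[c [c0 cK ->]]; rewrite (card_barycenters KC)//.
  have [s cs] := chain_top_exists cK.1.
  have Ks : K s := cK.2 _ (chain_in_top KC c0 cK cs).
  have [P PQ] := subdivided_interval (fsubset_refl s).
  have [Pk Pc _] := PQ.
  have [|p Pp /andP[_ cp]] := (Pc c).1.
    split; first exact: (proper_chain_in KC cK).
    by exists s => //; rewrite /between /= fsubset_refl.
  apply: leq_trans (fsubset_leq_card cp) _; have [_ ->] := Pk _ Pp.
  exact: Kle.
(* The empty chain is in one of the intervals for [(fset0, s0)]. *)
have [P PQ] := subdivided_interval (fsub0set s0).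
have [Pk Pc _] := PQ.
have [|p Pp _] := (Pc fset0).1.
  split; first by split=> [g h|]; rewrite inE.
  exists fset0; first by rewrite /between /= !fsub0set.
  by split=> [|h]; rewrite !inE.
have [_ pK] := chain_interval_Sd KC Ks0 PQ Pp; have [_ pn] := Pk _ Pp.
exists (barycenters p.2); last by rewrite (card_barycenters KC)// pn.
by apply/SdP; exists p.2; split=> //; rewrite -cardfs_gt0 pn s0n.
Qed.

Lemma Sd_tiling n K T : is_tiling n K T ->
  exists T', is_tiling n (Sd K) T' /\ forall t, T t -> disjoint_union_of T' t.
Proof.
move=> TT; have [KC Kn Ttile [Tcov _ _]] := TT.
suff [T' [T'T TU]] : exists T', is_tiling n (Sd K) T' /\
    forall t, T t -> disjoint_union_of T' (t `&` Defs.space (Sd K)).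
  exists T'; split=> // t Tt; have := TU t Tt.
  rewrite (space_Sd KC) setIidl// => x tx.
  by rewrite -Tcov; exists t.
apply: (induced_tiling TT).
- exact: simplicial_complex_Sd.
- exact: has_dimension_Sd.
- by rewrite space_Sd.
move=> t Tt; have [k _ /(cell_of_tile KC)[[r s] /= [Ks sn rs ->]]] := Ttile _ Tt.
have [P PQ] := subdivided_interval rs; have [Pk Pc Pd] := PQ.
have PK := chain_interval_Sd KC Ks PQ.
have bE q c : P q -> chain_in K c ->
    between (barycenters q.1, barycenters q.2) (barycenters c) = between q c.
  by move=> /PK[p1 p2] cK; rewrite /between /= !(barycenters_sub KC).
exists [set p | exists2 q, P q & p = (barycenters q.1, barycenters q.2)]; split.
- move=> _ [p Pp ->] /=; have [pp pn] := Pk _ Pp; have [p1 p2] := PK _ Pp.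
  rewrite (card_barycenters KC)// (barycenters_sub KC)// pn sn; split=> //.
  by apply/SdP; exists p.2; split=> //; rewrite -cardfs_gt0 pn sn.
- move=> _ x /SdP[c [c0 cK ->]] cx.
  have [g cg] := chain_top_exists cK.1.
  have gx := relint_chain_top KC c0 cK cg cx.
  have Kg : K g := cK.2 _ (chain_in_top KC c0 cK cg).
  rewrite (cell_relint (p := (r, s)) KC Ks Kg gx); split=> [rsg|].
    have [|p Pp pc] := (Pc c).1.
      by split; [exact: (proper_chain_in KC cK)|exists g].
    by exists (barycenters p.1, barycenters p.2); [exists p|rewrite bE].
  move=> [_ [p Pp ->]]; rewrite bE// => pc.
  have [_ [g' rsg' cg']] := interval_partition_cover PQ Pp pc.
  by rewrite (chain_top_unique cg cg').
- move=> _ _ _ /SdP[c [c0 cK ->]] [p Pp ->] [p' Pp' ->].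
  by rewrite !bE// => pc p'c; rewrite (Pd p p' c).
Qed.

Lemma disjoint_union_refl T t : T t -> t !=set0 -> disjoint_union_of T t.
Proof.
move=> Tt t0; exists [set t]; first by move=> _ ->.
split; first by rewrite /cover bigcup_set1.
- by move=> _ _ -> ->.
- by move=> _ ->.
Qed.

Lemma disjoint_union_trans T T' t : disjoint_union_of T t ->
  (forall u, T u -> disjoint_union_of T' u) -> disjoint_union_of T' t.
Proof.
move=> [U UT [Ucov Udisj _]] TT'.
have /choice[W WP] : forall u, exists W, U u -> W `<=` T' /\ partition W id u.
  move=> u; have [/UT/TT'[W WT' Wu]|nU] := pselect (U u); first by exists W.
  by exists set0.
have Wsub u w x : U u -> W u w -> w x -> u x.
  by move=> Uu Ww wx; have [_ [<- _ _]] := WP u Uu; exists w.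
exists [set w | exists2 u, U u & W u w].
  by move=> w [u Uu Ww]; have [WT' _] := WP u Uu; apply: WT'.
split.
- apply/seteqP; split=> x.
    move=> [w [u Uu Ww] wx]; rewrite -Ucov; exists u => //.
    exact: Wsub Ww wx.
  rewrite -Ucov => -[u Uu ux]; have [_ [Wcov _ _]] := WP u Uu.
  by move: ux; rewrite /= -Wcov => -[w Ww wx]; exists w => //; exists u.
- move=> w w' [u Uu Ww] [u' Uu' Ww'] [x [wx w'x]].
  have uu' : u = u'.
    by apply: Udisj => //; exists x; split; [apply: Wsub Ww wx|apply: Wsub Ww' w'x].
  subst u'; have [_ [_ Wdisj _]] := WP u Uu.
  by apply: Wdisj => //; exists x.
- by move=> w [u Uu Ww]; have [_ [_ _]] := WP u Uu; apply.
Qed.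

Lemma iter_Sd_tiling n d K T : is_tiling n K T ->
  exists T', induces_on_Sd n T d K T'.
Proof.
move=> TT; elim: d => [|d [T1 [T1T TT1]]].
  exists T; split=> // t Tt; apply: disjoint_union_refl => //.
  by have [_ _ _ [_ _]] := TT; apply.
have [T2 [T2T T1T2]] := Sd_tiling T1T.
exists T2; split=> // t Tt.
exact: disjoint_union_trans (TT1 _ Tt) T1T2.
Qed.

End InducedTilings.

Theorem theorem1p9 (R : realType) (E : lmodType R) (n : nat)
    (K : set {fset E}) :
  (0 < n)%N -> simplicial_complex K -> has_dimension K n -> tileable n K ->
  [/\ forall i : nat, (1 <= i <= n)%N -> tileable i (skeleton i K),
      forall d : nat, tileable n (iter d Sd K)
    & forall T : set (set E), is_tiling n K T ->
        (forall i : nat, (1 <= i <= n)%N ->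
           exists T' : set (set E), induces_on_skeleton T i K T') /\
        (forall d : nat,
           exists T' : set (set E), induces_on_Sd n T d K T')].
Proof.
move=> _ _ _ [T0 T0T].
have induced T : is_tiling n K T ->
    (forall i, (1 <= i <= n)%N -> exists T', induces_on_skeleton T i K T') /\
    (forall d, exists T', induces_on_Sd n T d K T').
  move=> TT; split=> [i /andP[_ ni]|d]; first exact: skeleton_tiling TT ni.
  exact: iter_Sd_tiling.
have [skel sub] := induced T0 T0T.
split=> [i /skel[T' [T'T _]]|d|//]; first by exists T'.
by have [T' [T'T _]] := sub d; exists T'.
Qed.
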